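(* Assume Martin's Axiom. Let $X$ be a compactum such that $t(X)=\omega$ and $\pi w(X)<\mathfrak{c}$. Then $\pi Nt(X)=\omega$.
   Context: A compactum is a compact Hausdorff space; $t(X)$ is the tightness and $\pi w(X)$ the $\pi$-weight; $\mathfrak{c}=2^{\aleph_0}$. Families of open sets are ordered by inclusion; a family is $\kappa^{\mathrm{op}}$-like if no member is contained in $\kappa$-many members. $\pi Nt(X)$ is the least $\kappa\geq\omega$ such that $X$ has a $\kappa^{\mathrm{op}}$-like $\pi$-base. *)

(* Defs.v *)
From HB Require Import structures.
From mathcomp Require Import all_boot all_order.
From mathcomp Require Import all_classical all_reals topology.
Set Implicit Arguments. Unset Strict Implicit. Unset Printing Implicit Defensive.
Local Open Scope classical_set_scope.
Local Open Scope card_scope.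

Definition lt_continuum (T : Type) (A : set T) : Prop :=
  A #<= [set: set nat] /\ ~ ([set: set nat] #<= A).

(* A poset (P, le) is presented by a partial order relation; q "le" p means
   q is stronger than (extends) p. *)
Definition is_partial_order (P : Type) (le : P -> P -> Prop) : Prop :=
  (forall p, le p p) /\
  (forall p q r, le p q -> le q r -> le p r) /\
  (forall p q, le p q -> le q p -> p = q).

Definition compatible (P : Type) (le : P -> P -> Prop) (p q : P) : Prop :=
  exists r, le r p /\ le r q.

Definition antichain (P : Type) (le : P -> P -> Prop) (A : set P) : Prop :=
  forall p q, A p -> A q -> p <> q -> ~ compatible le p q.

Definition ccc (P : Type) (le : P -> P -> Prop) : Prop :=
  forall A : set P, antichain le A -> countable A.

Definition dense_in (P : Type) (le : P -> P -> Prop) (D : set P) : Prop :=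
  forall p, exists q, D q /\ le q p.

Definition filter_in (P : Type) (le : P -> P -> Prop) (G : set P) : Prop :=
  G !=set0 /\
  (forall p q, G p -> le p q -> G q) /\
  (forall p q, G p -> G q -> exists r, G r /\ le r p /\ le r q).

Definition MartinsAxiom : Prop :=
  forall (P : Type) (le : P -> P -> Prop),
    inhabited P -> is_partial_order le -> ccc le ->
    forall Dfam : set (set P),
      lt_continuum Dfam ->
      (forall D, Dfam D -> dense_in le D) ->
      exists G : set P, filter_in le G /\ (forall D, Dfam D -> G `&` D !=set0).

Definition countable_tightness (X : topologicalType) : Prop :=
  forall (A : set X) (x : X), closure A x ->
    exists B : set X, B `<=` A /\ countable B /\ closure B x.

Definition pi_base (X : topologicalType) (B : set (set X)) : Prop :=
  (forall U, B U -> open U /\ U !=set0) /\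
  (forall V : set X, open V -> V !=set0 -> exists U, B U /\ U `<=` V).

Definition pi_weight_lt_continuum (X : topologicalType) : Prop :=
  exists B : set (set X), pi_base B /\ lt_continuum B.

Definition omega_op_like (X : Type) (B : set (set X)) : Prop :=
  forall U, B U -> finite_set [set V | B V /\ U `<=` V].

(* pi Nt(X) = omega: X has an omega^op-like pi-base
   (pi Nt(X) >= omega holds by definition) *)
Definition piNt_eq_omega (X : topologicalType) : Prop :=
  exists B : set (set X), pi_base B /\ omega_op_like B.

(* Main.v *)
(** A free sequence of length omega_1 in a compactum contradicts countable
    tightness.  This gives, first, a countable local pi-base at every point
    and, second (Shapirovskii), a map [U |-> V U] shrinking the nonempty open
    sets such that every centered subfamily of its range is countable.  Let [B]
    be the image under [V] of a pi-base of size less than the continuum.  Force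
    with the finite subsets of [B], where [q] extends [p] when [p <= q] and no
    member of [q \ p] contains a member of [p].  Given uncountably many
    pairwise incompatible conditions, an ultrafilter on them produces an
    uncountable centered subfamily of [B], so this order is ccc; the union of a
    sufficiently generic filter is a pi-base, and each member is contained only
    in members of one finite condition. *)

Require Import Defs.
From mathcomp Require Import all_boot all_order.
From mathcomp Require Import all_classical all_reals topology.
Set Implicit Arguments. Unset Strict Implicit. Unset Printing Implicit Defensive.
Local Open Scope classical_set_scope.

(** * Well-orders and free sequences *)

Definition strict_well_order {W : Type} (lt : W -> W -> Prop) : Prop :=
  [/\ well_founded lt, forall a b c, lt a b -> lt b c -> lt a c &
      forall a b, [\/ lt a b, a = b | lt b a]].

Lemma strict_well_order_exists (W : choiceType) :
  exists lt : W -> W -> Prop, strict_well_order lt.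
Proof.
have [R Rwo] := wochoice.well_ordering_principle W.
have Rch : wochoice.wo_chain R predT by move=> A _; exact: Rwo.
have Rtot a b : R a b || R b a by exact: (wochoice.wo_chainW Rch).
have Ranti a b : R a b -> R b a -> a = b.
  by move=> ab ba; apply: (wochoice.wo_chain_antisymmetric Rch) => //; apply/andP.
have Rmin (A : set W) : A !=set0 -> exists2 z, A z & forall x, A x -> R z x.
  move=> [x Ax]; have [|z [[zA zmin] _]] := Rwo (mem A).
    by exists x; rewrite inE.
  exists z; first by move: zA; rewrite inE.
  by move=> y Ay; apply: zmin; rewrite inE.
have Rtrans a b c : R a b -> R b c -> R a c.
  move=> ab bc; have [|z [[->|->]|->] zm] := Rmin [set a; b; c].
  - by exists a; left; left.
  - by apply: zm; right.
  - have -> : a = b by apply: Ranti => //; apply: zm; left; left.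
    by [].
  - have <- : b = c by apply: Ranti => //; apply: zm; left; right.
    by [].
exists (fun a b => R a b /\ a <> b); split.
- move=> a; apply: contrapT => nacc.
  have [|z nz zm] := Rmin [set x | ~ Acc (fun a b => R a b /\ a <> b) x].
    by exists a.
  apply: nz; constructor => y [yz nyz]; apply: contrapT => ny.
  by apply: nyz; apply: Ranti => //; exact: zm.
- move=> a b c [ab nab] [bc nbc]; split; first exact: Rtrans ab bc.
  by move=> eac; apply: nab; apply: Ranti => //; rewrite eac.
- move=> a b; have [eab|nab] := pselect (a = b); first by constructor 2.
  case/orP: (Rtot a b) => h; [constructor 1|constructor 3]; split=> // eba.
  exact: nab.
Qed.

(** The step receives a total function, cut off to [dflt] outside the predecessors of [c]; this
    keeps later recursions free of dependent types. *)
Lemma wf_recursion {W S : Type} (lt : W -> W -> Prop) (dflt : S)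
    (step : W -> (W -> S) -> S) : well_founded lt ->
  exists f : W -> S,
    forall c, f c = step c (fun b => if `[< lt b c >] then f b else dflt).
Proof.
move=> wf.
pose F c (g : forall b, lt b c -> S) :=
  step c (fun b => if pselect (lt b c) is left h then g b h else dflt).
exists (Fix wf (fun=> S) F) => c.
rewrite Fix_eq; last first.
  move=> x f g fg; rewrite /F; congr (step x _); apply/funext => b.
  by case: pselect => // h; rewrite fg.
rewrite /F; congr (step c _); apply/funext => b.
by case: pselect => h; [rewrite asboolT|rewrite asboolF].
Qed.

(** For a well-order [lt], this expresses that [R] has order type omega_1. *)
Definition omega1_like {W : Type} (lt : W -> W -> Prop) (R : set W) : Prop :=
  ~ countable R /\ forall a, R a -> countable [set b | R b /\ lt b a].

(** If some element of [R] has uncountably many predecessors in [R], the predecessors of the least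
    such element form [R']. *)
Lemma omega1_like_exists {W : Type} (lt : W -> W -> Prop) (R : set W) :
  strict_well_order lt -> ~ countable R ->
  exists R' : set W, R' `<=` R /\ omega1_like lt R'.
Proof.
move=> [wf tr tot] Runc.
have [Rsmall|] := pselect (forall a, R a -> countable [set b | R b /\ lt b a]).
  by exists R; split; [|split].
move=> /existsNP[a /not_implyP[Ra]].
elim/(well_founded_ind wf): a Ra => a IH Ra aunc.
have [asmall|] := pselect (forall b, R b -> lt b a ->
    countable [set d | R d /\ lt d b]).
  exists [set b | R b /\ lt b a]; split=> [b []//|]; split=> // b [Rb ba].
  apply: sub_countable (asmall b Rb ba); apply: subset_card_le.
  by move=> d /= [[]].
move=> /existsNP[b /not_implyP[Rb /not_implyP[ba bunc]]].
exact: IH bunc.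
Qed.

Lemma countable_setU {T : Type} (A B : set T) :
  countable A -> countable B -> countable (A `|` B).
Proof. by move=> cA cB; rewrite -bigcup2E; apply: bigcup_countable => // -[|[|]]. Qed.

Lemma omega1_like_unbounded {W : Type} (lt : W -> W -> Prop) (R C : set W) :
  strict_well_order lt -> omega1_like lt R -> C `<=` R -> countable C ->
  exists2 a, R a & forall c, C c -> lt c a.
Proof.
move=> [_ tr tot] [Runc Rsmall] CR Ccnt; apply: contrapT => nobd; apply: Runc.
suff RC : R `<=` \bigcup_(c in C) (c |` [set b | R b /\ lt b c]).
  apply: sub_countable (subset_card_le RC) _; apply: bigcup_countable => // c Cc.
  by apply: countable_setU; [exact: countable1|exact/Rsmall/CR].
move=> a Ra; apply: contrapT => naC; apply: nobd; exists a => // c Cc.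
case: (tot c a) => // [ca|ac]; exfalso; apply: naC; exists c => //.
  by left.
by right.
Qed.

Definition centered {X : Type} (C : set (set X)) : Prop :=
  forall D, D `<=` C -> finite_set D -> \bigcap_(A in D) A !=set0.

Lemma centered_sub {X : Type} (C D : set (set X)) :
  D `<=` C -> centered C -> centered D.
Proof. by move=> DC cC E ED; apply: cC; exact: subset_trans DC. Qed.

Lemma compact_centered_closure {X : topologicalType} (C : set (set X)) :
  compact [set: X] -> centered C -> exists x, forall A, C A -> closure A x.
Proof.
move=> cX cC.
pose F := filter_from [set D | D `<=` C /\ finite_set D]
  (fun D => \bigcap_(A in D) A).
have FF : ProperFilter F.
  apply: filter_from_proper; last by move=> D [DC fD]; exact: cC.
  apply: filter_from_filter; first by exists set0; split.
  move=> D E [DC fD] [EC fE]; exists (D `|` E); last by rewrite bigcap_setU.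
  by split; [rewrite subUset | rewrite finite_setU].
have [x [_ Fx]] := cX F FF filterT.
exists x => A CA B nB; apply: Fx => //; exists [set A]; last by rewrite bigcap_set1.
by split=> // ? ->.
Qed.

(** The tails of [z] are centered, so some [y] lies in the closure of each. By tightness [y] is in
    the closure of countably many terms, all indexed below some [a]; hence [y] lies in [A a], while
    the tail past [a] puts it in [K a]. *)
Lemma no_free_omega1_sequence {X : topologicalType} {W : Type}
    (lt : W -> W -> Prop) (R : set W) (z : W -> X) (A K : W -> set X) :
  compact [set: X] -> countable_tightness X ->
  strict_well_order lt -> omega1_like lt R ->
  (forall a, R a -> closed (A a) /\ closed (K a)) ->
  (forall a x, R a -> A a x -> K a x -> False) ->
  (forall a b, R a -> R b -> lt b a -> A a (z b)) ->
  (forall a b, R a -> R b -> lt a b -> K a (z b)) -> False.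
Proof.
move=> cX tX lto R1 clAK disj zA zK.
pose tail a := z @` [set b | R b /\ lt a b].
have cent : centered (tail @` R).
  move=> D DR /finite_set_countable Dcnt.
  have /choice[f fP] : forall T, exists a, D T -> R a /\ tail a = T.
    move=> T; have [DT|nDT] := pselect (D T); last first.
      by have [a _ _] := omega1_like_unbounded (C := set0) lto R1
        (@sub0set _ _) (@countable0 _); exists a.
    by have [a Ra aT] := DR _ DT; exists a.
  have fDR : f @` D `<=` R by move=> _ [T DT <-]; have [] := fP T DT.
  have [a Ra aub] := omega1_like_unbounded lto R1 fDR
    (sub_countable (card_image_le _ _) Dcnt).
  exists (z a) => T DT; have [_ <-] := fP T DT; exists a => //; split => //.
  by apply: aub; exists T.
have [y yP] := compact_centered_closure cX cent.
have [|B [BzR [Bcnt By]]] := tX (z @` R) y.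
  have [a Ra _] := omega1_like_unbounded (C := set0) lto R1
        (@sub0set _ _) (@countable0 _).
  apply: (closureS (A := tail a)); last by apply: yP; exists a.
  by move=> _ [b [Rb _] <-]; exists b.
have /choice[g gP] : forall x, exists a, B x -> R a /\ z a = x.
  move=> x; have [Bx|nBx] := pselect (B x).
    by have [a Ra ax] := BzR _ Bx; exists a.
  by have [a _ _] := omega1_like_unbounded (C := set0) lto R1
        (@sub0set _ _) (@countable0 _); exists a.
have gBR : g @` B `<=` R by move=> _ [x Bx <-]; have [] := gP x Bx.
have [a Ra aub] := omega1_like_unbounded lto R1 gBR
    (sub_countable (card_image_le _ _) Bcnt).
have [clA clK] := clAK a Ra.
apply: (disj a y Ra).
  move/closure_id: clA => ->; apply: closureS By => x Bx.
  have [Rg <-] := gP x Bx; apply: zA => //; apply: aub; exact: imageP.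
move/closure_id: clK => ->; apply: (closureS (A := tail a)).
  by move=> _ [b [Rb ab] <-]; exact: zK.
by apply: yP; exists a.
Qed.

Lemma finite_bigcap_open {X : topologicalType} (D : set (set X)) :
  finite_set D -> (forall A, D A -> open A) -> open (\bigcap_(A in D) A).
Proof.
move=> /finite_seqP[s ->]; elim: s => [|A s IH] Ds.
  by rewrite (_ : [set` [::]] = set0) ?bigcap_set0; [exact: openT|apply/seteqP; split].
have -> : [set` A :: s] = A |` [set` s].
  by apply/seteqP; split=> B /=; rewrite inE; [case/predU1P; [left|right]|
    case=> [->|->]; rewrite ?eqxx ?orbT].
rewrite bigcap_setU1; apply: openI; first by apply: Ds => /=; rewrite inE eqxx.
by apply: IH => B sB; apply: Ds => /=; rewrite inE; apply/orP; right.
Qed.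

Lemma regular_shrink {X : topologicalType} (x : X) (U : set X) :
  hausdorff_space X -> compact [set: X] -> open U -> U x ->
  exists V, [/\ open V, V x & closure V `<=` U].
Proof.
move=> hX cX oU Ux.
have [B nB BU] := compact_regular hX cX (filterT : nbhs x setT)
  (open_nbhs_nbhs (conj oU Ux)).
exists (interior B); split; [exact: open_interior|exact: nB|].
by apply: subset_trans BU; apply: closureS; exact: interior_subset.
Qed.

(** * Countable local pi-bases *)

Lemma strict_well_order_asym {W : Type} (lt : W -> W -> Prop) a b :
  strict_well_order lt -> lt a b -> ~ lt b a.
Proof.
move=> [wf tr _] ab ba; suff irr c : ~ lt c c by exact: irr (tr _ _ _ ab ba).
by elim/(well_founded_ind wf): c => c IH cc; exact: (IH c cc cc).
Qed.

Lemma seq_max {W : eqType} (lt : W -> W -> Prop) (l : seq W) :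
  strict_well_order lt -> l <> [::] ->
  exists2 m, m \in l & forall b, b \in l -> b = m \/ lt b m.
Proof.
move=> [wf tr tot]; elim: l => // a l IH _.
have [->|/eqP/IH[m ml mP]] := eqVneq l [::].
  by exists a => [|b]; rewrite ?inE // => /eqP; left.
have [am|am|ma] := tot a m.
- exists m; first by rewrite inE ml orbT.
  by move=> b; rewrite inE => /orP[/eqP->|/mP//]; right.
- exists m; first by rewrite inE ml orbT.
  by move=> b; rewrite inE => /orP[/eqP->|/mP//]; left.
- exists a; first by rewrite inE eqxx.
  move=> b; rewrite inE => /orP[/eqP->|/mP[->|bm]]; [by left|by right|right].
  exact: tr bm ma.
Qed.

Lemma uncountable_set_nat : ~ countable [set: set nat].
Proof.
move=> /countable_injP[f finj].
pose D := [set n | exists2 A : set nat, f A = n & ~ A n].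
have fI A B : f A = f B -> A = B by apply: finj; rewrite inE.
have [DfD|nDfD] := pselect (D (f D)).
  by have [A /fI -> ] := DfD.
by apply: (nDfD); exists D.
Qed.

Section LocalPiBase.
Variables (X : topologicalType) (p : X).
Hypotheses (hX : hausdorff_space X) (cX : compact [set: X]).

Definition local_pi_base (P : set (set X)) : Prop :=
  (forall A, P A -> open A /\ A !=set0) /\
  (forall V, open V -> V p -> exists2 A, P A & A `<=` V).

Definition separator (base : set (set X)) (U H : set X) : Prop :=
  [/\ open U, open H, U p, closure U `&` closure H = set0 &
      forall D, D `<=` base -> finite_set D -> \bigcap_(A in D) A !=set0 ->
        (\bigcap_(A in D) A) `&` H !=set0].

(** The nonempty finite intersections from [base] are countably many open sets, so they are no local
    pi-base: some neighbourhood [V] of [p] contains none of them. Regularity, used twice, fits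
    [closure U] into [G] and [closure G] into [V]; each intersection then leaves [closure G]. *)
Lemma separator_exists (base : set (set X)) :
  ~ (exists2 P, countable P & local_pi_base P) ->
  countable base -> (forall A, base A -> open A) ->
  exists U H, separator base U H.
Proof.
move=> nP cb ob.
pose P := [set A | A !=set0] `&`
  (fun D => \bigcap_(A in D) A) @` [set D | D `<=` base /\ finite_set D].
have cP : countable P.
  apply: sub_countable (countable_finite_subset cb).
  exact: card_le_trans (subset_card_le (@subIsetr _ _ _)) (card_image_le _ _).
have [V [oV Vp PV]] : exists V, [/\ open V, V p & forall A, P A -> ~ A `<=` V].
  apply: contrapT => nV; apply: nP; exists P => //; split.
    move=> A [A0 [D [Db fD] AE]]; split=> //; rewrite -AE.
    by apply: finite_bigcap_open => // B /Db; exact: ob.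
  move=> V oV Vp; apply: contrapT => nA; apply: nV; exists V; split=> // A PA AV.
  by apply: nA; exists A.
have [G [oG Gp GV]] := regular_shrink hX cX oV Vp.
have [U [oU Up UG]] := regular_shrink hX cX oG Gp.
exists U, (~` closure G); split=> //.
- exact/closed_openC/closed_closure.
- apply/seteqP; split=> // x [/UG Gx clx].
  have [y [nGy Gy]] := clx G (open_nbhs_nbhs (conj oG Gx)).
  exact/nGy/subset_closure.
- move=> D Db fD D0; apply: contrapT => nH.
  apply: (PV (\bigcap_(A in D) A)); first by split=> //; exists D.
  move=> x Dx; apply: contrapT => nVx; apply: nH; exists x; split=> // clGx.
  exact/nVx/GV.
Qed.

Hypothesis tX : countable_tightness X.

Lemma countable_local_pi_base : exists2 P, countable P & local_pi_base P.
Proof.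
apply: contrapT => nP.
have [lt lto] := strict_well_order_exists (set nat).
have [R [_ R1]] := omega1_like_exists lto uncountable_set_nat.
have [wf tr tot] := lto.
have /choice[sel selP] : forall base : set (set X), exists UH : set X * set X,
    countable base -> (forall A, base A -> open A) -> separator base UH.1 UH.2.
  move=> base; have [[cb ob]|nb] := pselect (countable base /\
      forall A, base A -> open A).
    by have [U [H UH]] := separator_exists nP cb ob; exists (U, H).
  by exists (set0, set0) => cb ob; exfalso; exact: nb.
pose base (a : set nat) (g : set nat -> set X * set X) :=
  \bigcup_(b in [set b | R b /\ lt b a]) [set (g b).1; (g b).2].
have [f fE] := wf_recursion (set0, set0) (fun a g => sel (base a g)) wf.
have baseE a : base a (fun b => if `[< lt b a >] then f b else (set0, set0)) =
    base a f.
  by apply: eq_bigcupr => b [_ ba]; rewrite asboolT.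
have {baseE fE} fE a : f a = sel (base a f) by rewrite fE baseE.
have fP a : R a -> separator (base a f) (f a).1 (f a).2.
  elim/(well_founded_ind wf): a => a IH Ra; rewrite fE; apply: selP.
    apply: bigcup_countable; first exact: R1.2.
    by move=> b _; apply: finite_set_countable; exact: finite_set2.
  by move=> A [b [Rb ba]] [->|->]; have [] := IH b ba Rb.
(* Before [c] take the set around [p], from [c] on the set separated from it. A common point [z c]
   of the closures, for each [c], yields the free sequence. *)
pose E c b := if `[< lt b c >] then (f b).1 else (f b).2.
have Ebase c a b : R b -> lt b a -> base a f (E c b).
  by move=> Rb ba; exists b => //; rewrite /E; case: asboolP; [left|right].
(* Induction on the largest index [m] in the list: if [m] precedes [c], all the sets contain [p];
   otherwise the sets of smaller index have a common point by induction, and the second set of stage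
   [m] meets their intersection. *)
have Ecap c a (l : seq (set nat)) :
    (forall b, b \in l -> R b /\ lt b a) -> exists x, forall b, b \in l -> E c b x.
  elim/(well_founded_ind wf): a l => a IH l lP.
  have [->|/eqP l0] := eqVneq l [::]; first by exists p.
  have [m ml mP] := seq_max lto l0; have [Rm ma] := lP m ml.
  have [mc|nmc] := pselect (lt m c).
    exists p => b bl; rewrite /E asboolT.
      by have [Rb _] := lP b bl; have [] := fP b Rb.
    by case: (mP b bl) => [->//|bm]; exact: tr bm mc.
  have lm b : b \in [seq b <- l | b != m] -> R b /\ lt b m.
    rewrite mem_filter => /andP[/eqP bm bl]; split; first exact: (lP b bl).1.
    by case: (mP b bl).
  have [x xP] := IH m ma _ lm; have [_ _ _ _ mH] := fP m Rm.
  have [|||y [yD yH]] := mH [set` [seq E c b | b <- [seq b <- l | b != m]]].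
  - by move=> A /= /mapP[b /lm[Rb bm] ->]; exact: Ebase.
  - by apply/finite_seqP; eexists.
  - by exists x => A /= /mapP[b bl ->]; exact: xP.
  exists y => b bl; have [->|bm] := eqVneq b m; first by rewrite /E asboolF.
  by apply: yD => /=; apply: map_f; rewrite mem_filter bm.
have cent c : centered (E c @` R).
  move=> _ /[swap] /finite_seqP[s ->] sR.
  have /choice[h hP] : forall A, exists b, A \in s -> R b /\ E c b = A.
    move=> A; have [As|nAs] := boolP (A \in s); last by exists set0.
    by have [b Rb bA] := sR A As; exists b.
  have hsR : [set` map h s] `<=` R by move=> _ /= /mapP[A As ->]; exact: (hP A As).1.
  have [|a Ra aub] := omega1_like_unbounded lto R1 hsR.
    by apply: finite_set_countable; apply/finite_seqP; eexists.
  have [x xP] := Ecap c a (map h s) (fun b bs => conj (hsR b bs) (aub b bs)).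
  exists x => A /= As; have [_ <-] := hP A As; apply: xP; exact: map_f.
have /choice[z zP] : forall c, exists x, forall b, R b -> closure (E c b) x.
  move=> c; have [x xP] := compact_centered_closure cX (cent c).
  by exists x => b Rb; apply: xP; exists b.
apply: (@no_free_omega1_sequence X _ lt R z (fun a => closure (f a).2)
  (fun a => closure (f a).1)) => //.
- by move=> a Ra; split; exact: closed_closure.
- move=> a x Ra ax1 ax2; have [_ _ _ dis _] := fP a Ra.
  by have : set0 x by rewrite -dis; split.
- move=> a b Ra Rb ba; have := zP b a Ra; rewrite /E asboolF //.
  exact: strict_well_order_asym ba.
- by move=> a b Ra Rb ab; have := zP b a Ra; rewrite /E asboolT.
Qed.

End LocalPiBase.

(** * Thinning the open sets *)

Lemma local_pi_base_within (X : topologicalType) (O : set X) :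
  hausdorff_space X -> compact [set: X] -> countable_tightness X ->
  open O -> O !=set0 ->
  exists x (P : nat -> set X), [/\ O x,
    forall n, [/\ open (P n), P n !=set0 & closure (P n) `<=` O] &
    forall V, open V -> V x -> exists n, P n `<=` V].
Proof.
move=> hX cX tX oO [x Ox].
have [P0 cP0 [oP0 P0x]] := countable_local_pi_base x hX cX tX.
pose P1 := P0 `&` [set A | closure A `<=` O].
have cP1 : countable P1.
  by apply: sub_countable cP0; apply: subset_card_le; exact: subIsetl.
have P1x V : open V -> V x -> exists2 A, P1 A & A `<=` V.
  move=> oV Vx; have [O' [oO' O'x clO']] := regular_shrink hX cX oO Ox.
  have [A PA AVO] := P0x (V `&` O') (openI oV oO') (conj Vx O'x).
  exists A; last by move=> y /AVO[].
  split=> //; apply: subset_trans clO'; apply: closureS => y /AVO[] //.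
have [P10|[P]] := pfcard_geP cP1.
  by have [A] := P1x setT openT I; rewrite P10.
exists x, P; split=> // [n|V oV Vx].
  have [PPn clPn] : P1 (P n) by exact: funS.
  by have [? ?] := oP0 _ PPn.
by have [A /(@surj _ _ _ _ P)[n _ <-] AV] := P1x V oV Vx; exists n.
Qed.

(* Families are indexed by words over [W + nat]: the words over an initial
   segment of [W] are closed under coding of finite sequences, and adding one
   more element of [W] is absorbed by the naturals.  The induction on initial
   segments of [W] therefore needs no cardinal arithmetic. *)
Section Words.
Variable W : eqType.
Local Notation letter := (W + nat)%type.

Definition words (D : set W) : set (seq letter) :=
  [set w | forall d, inl d \in w -> D d].

Lemma words_sub (D E : set W) : D `<=` E -> words D `<=` words E.
Proof. by move=> DE w wD d /wD /DE. Qed.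

Lemma words_cons (D : set W) d w : D d -> words D w -> words D (inl d :: w).
Proof. by move=> Dd wD e; rewrite inE => /orP[/eqP[->]|/wD]. Qed.

Lemma words_cons_nat (D : set W) n w : words D w -> words D (inr n :: w).
Proof. by move=> wD e; rewrite inE => /orP[/eqP|/wD]. Qed.

Lemma countable_words0 : countable (words set0).
Proof.
suff sub : words set0 `<=` map inr @` [set: seq nat].
  apply: sub_countable (subset_card_le sub) _.
  exact: sub_countable (card_image_le _ _) _.
elim=> [|[d|n] w IH] ww; first by exists [::].
  by case: (ww d); rewrite inE eqxx.
by have [|s _ <-] := IH; [move=> d dw; apply: ww; rewrite inE dw orbT|exists (n :: s)].
Qed.

Definition letter_nat (l : letter) : nat := if l is inr n then n else 0%N.

(** The stored lengths allow [flatten ws] to be cut back into its words. *)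
Definition encode (n : nat) (ws : seq (seq letter)) : seq letter :=
  [:: inr n, inr (size ws) & [seq inr (size w) | w <- ws] ++ flatten ws].

Definition decode (w : seq letter) : nat * seq (seq letter) :=
  let k := letter_nat (nth (inr 0%N) w 1) in
  (letter_nat (nth (inr 0%N) w 0),
   reshape (map letter_nat (take k (drop 2 w))) (drop k (drop 2 w))).

Lemma encodeK n ws : decode (encode n ws) = (n, ws).
Proof.
rewrite /decode /encode /= drop0; congr pair.
rewrite take_size_cat ?size_map // drop_size_cat ?size_map //.
by rewrite -map_comp -[RHS]flattenK.
Qed.

Lemma words_encode (D : set W) n ws :
  (forall w, w \in ws -> words D w) -> words D (encode n ws).
Proof.
move=> wsD; do 2!apply: words_cons_nat => //.
move=> d; rewrite mem_cat => /orP[/mapP[]//|/flattenP[w wws dw]].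
exact: wsD dw.
Qed.

End Words.

Definition centered_countable {X : Type} (B : set (set X)) : Prop :=
  forall C, C `<=` B -> centered C -> countable C.

Section Thinning.
Variables (X : topologicalType) (W : choiceType) (lt : W -> W -> Prop).
Hypotheses (hX : hausdorff_space X) (cX : compact [set: X])
  (tX : countable_tightness X) (lto : strict_well_order lt).

Definition le_set (c : W) : set W := [set d | lt d c \/ d = c].

(** Nonemptiness and [centered_countable] are demanded only on words over [D], so that [D] can grow
    along the well-order. *)
Definition thinnable (D : set W) : Prop :=
  forall F : seq (W + nat) -> set X, (forall w, open (F w)) ->
  exists V : seq (W + nat) -> set X,
    [/\ forall w, open (V w), forall w, V w `<=` F w,
        forall w, words D w -> F w !=set0 -> V w !=set0 &
        centered_countable (V @` words D)].

Lemma thinnable_set0 : thinnable set0.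
Proof.
move=> F oF; exists F; split=> [//|w|//|C CF _]; first exact: subset_refl.
apply: sub_countable (subset_card_le CF) _.
exact: sub_countable (card_image_le _ _) (countable_words0 W).
Qed.

(** Renaming the letter [c] to [inr 0] and shifting each [inr n] to [inr n.+1] embeds the words over
    [le_set c] into the words over the predecessors of [c]. *)
Lemma thinnable_le_set c : thinnable [set d | lt d c] -> thinnable (le_set c).
Proof.
move=> thin F oF.
pose phi (l : W + nat) : W + nat :=
  match l with inl d => if d == c then inr 0%N else inl d | inr n => inr n.+1 end.
pose psi (l : W + nat) : W + nat :=
  match l with inl d => inl d | inr n => if n is k.+1 then inr k else inl c end.
have phiK : cancel phi psi by move=> [d|n] //=; case: eqP => [->|].
have words_phi w : words (le_set c) w -> words [set d | lt d c] (map phi w).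
  move=> wc d /mapP[[e|//] ew] /=; case: eqP => // /eqP ec [->].
  by case: (wc e ew) => // /eqP; rewrite (negPf ec).
have [V [oV VF V0 Vc]] := thin (F \o map psi) (fun w => oF _).
exists (V \o map phi); split=> [w|w|w ww Fw|].
- exact: oV.
- by have := VF (map phi w); rewrite /= (mapK phiK).
- by apply: V0; [exact: words_phi|rewrite /= (mapK phiK)].
- move=> C CV; apply: Vc => A /CV[w ww <-]; exists (map phi w) => //.
  exact: words_phi.
Qed.

(** * Transfinite construction of points and sets along an initial segment *)

Section Stages.
Variables (D : set W) (U : seq (W + nat) -> set X).
Hypotheses (Ddown : forall c d, D c -> lt d c -> D d) (D0 : D !=set0)
  (oU : forall w, open (U w)).
Variables (pt : set X -> X) (P : set X -> nat -> set X)
  (G : W -> (seq (W + nat) -> set X) -> seq (W + nat) -> set X).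
Hypothesis ptP : forall O, open O -> O !=set0 -> [/\ O (pt O),
  forall n, [/\ open (P O n), P O n !=set0 & closure (P O n) `<=` O] &
  forall V, open V -> V (pt O) -> exists n, P O n `<=` V].
Hypothesis GP : forall c F, D c -> (forall w, open (F w)) ->
  [/\ forall w, open (G c F w), forall w, G c F w `<=` F w,
      forall w, words (le_set c) w -> F w !=set0 -> G c F w !=set0 &
      centered_countable (G c F @` words (le_set c))].

Local Notation state := (set X * (seq (W + nat) -> set X))%type.

Definition earlier_points (c : W) (g : W -> state) : set X :=
  \bigcup_(d in [set d | lt d c]) (g d).1.

(* The word [inl d :: t] names the set produced for [t] at stage [d], and
   [inr n :: t] names [U t]; other words name the whole space. *)
Definition named_set (c : W) (g : W -> state) (v : seq (W + nat)) : set X :=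
  match v with
  | inl d :: t =>
      if `[< lt d c /\ words (le_set d) t >] then (g d).2 t else setT
  | inr _ :: t => U t
  | [::] => setT
  end.

Definition named_cap c g (ws : seq (seq (W + nat))) : set X :=
  \bigcap_(v in [set` ws]) named_set c g v.

Definition unmet c g ws : Prop :=
  [/\ open (named_cap c g ws), named_cap c g ws !=set0 &
      named_cap c g ws `&` earlier_points c g = set0].

Definition new_points c g : set X :=
  [set x | exists ws, [/\ forall v, v \in ws -> words (le_set c) v,
                          unmet c g ws & x = pt (named_cap c g ws)]].

(** The word codes a number and finitely many names. An unmet intersection contributes the members
    of the local pi-base at its chosen point; met ones contribute only the empty set. *)
Definition new_sets c g (w : seq (W + nat)) : set X :=
  if `[< unmet c g (decode w).2 >]
  then P (named_cap c g (decode w).2) (decode w).1 else set0.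

Definition stage c (g : W -> state) : state :=
  (earlier_points c g `|` new_points c g, G c (new_sets c g)).

Lemma stage_ext c g g' : (forall d, lt d c -> g d = g' d) ->
  stage c g = stage c g'.
Proof.
move=> gg'.
have eE : earlier_points c g = earlier_points c g'.
  by apply: eq_bigcupr => d dc; rewrite gg'.
have nE : named_cap c g = named_cap c g'.
  apply/funext => ws; apply: eq_bigcapr => -[|[d|n] t] //= _.
  by case: asboolP => // -[dc _]; rewrite gg'.
have uE : unmet c g = unmet c g' by rewrite /unmet eE nE.
by rewrite /stage /new_points /new_sets eE uE nE.
Qed.

Lemma new_sets_open c g w : open (new_sets c g w).
Proof.
rewrite /new_sets; case: asboolP => [[oN N0 _]|_]; last exact: open0.
by have [_ /(_ (decode w).1)[]] := ptP oN N0.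
Qed.

Variable f : W -> state.
Hypothesis fE : forall c, f c = stage c f.

Lemma stage_setsP c : D c ->
  [/\ forall w, open ((f c).2 w), forall w, (f c).2 w `<=` new_sets c f w,
      forall w, words (le_set c) w -> new_sets c f w !=set0 -> (f c).2 w !=set0 &
      centered_countable ((f c).2 @` words (le_set c))].
Proof. by move=> Dc; rewrite fE; apply: GP => // w; exact: new_sets_open. Qed.

Lemma named_cap_open c ws : D c -> open (named_cap c f ws).
Proof.
move=> Dc.
have -> : named_cap c f ws = \bigcap_(A in named_set c f @` [set` ws]) A.
  by rewrite bigcap_image.
apply: finite_bigcap_open.
  by apply: finite_image; apply/finite_seqP; exists ws.
move=> _ [[|[d|n] t] _ <-] /=; [exact: openT| |exact: oU].
case: asboolP => [[dc _]|_]; last exact: openT.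
by have [] := stage_setsP (Ddown Dc dc).
Qed.

(** Either an earlier point already lies in the intersection, or the intersection is unmet and its
    chosen point is added at stage [c]. *)
Lemma stage_points_meet c ws : D c ->
  (forall v, v \in ws -> words (le_set c) v) ->
  named_cap c f ws !=set0 -> named_cap c f ws `&` (f c).1 !=set0.
Proof.
move=> Dc wsc N0; have oN := named_cap_open ws Dc.
have [e0|/eqP/set0P[x [Nx ex]]] :=
    pselect (named_cap c f ws `&` earlier_points c f = set0).
  exists (pt (named_cap c f ws)); split; first by have [] := ptP oN N0.
  by rewrite fE; right; exists ws.
by exists x; split=> //; rewrite fE; left.
Qed.

(** The closure of a nonempty new set lies in an open set free of earlier points, and such an open
    set also misses their closure. *)
Lemma stage_sets_disjoint c w x : D c ->
  closure (earlier_points c f) x -> closure ((f c).2 w) x -> False.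
Proof.
move=> Dc clx clw; have [_ /(_ w) sub _ _] := stage_setsP Dc.
move: sub; rewrite /new_sets; case: asboolP => [[oN N0 Ne]|_] sub.
  have [_ /(_ (decode w).1)[_ _ clP] _] := ptP oN N0.
  have Nx := clP _ (closureS sub clw).
  have [y [ey Ny]] := clx _ (open_nbhs_nbhs (conj oN Nx)).
  by have : set0 y by rewrite -Ne.
by have := closureS sub clw; rewrite closure0.
Qed.

Lemma stage_pointsP c x : D c -> (f c).1 x ->
  exists d ws, [/\ D d, forall v, v \in ws -> words (le_set d) v,
                   unmet d f ws & x = pt (named_cap d f ws)].
Proof.
have [wf _ _] := lto.
elim/(well_founded_ind wf): c => c IH Dc; rewrite fE => -[[d dc dx]|].
  exact: IH d dc (Ddown Dc dc) dx.
by move=> [ws [wsc un xE]]; exists c, ws.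
Qed.

Lemma words_le_set w : words D w -> exists2 c, D c & words (le_set c) w.
Proof.
have [_ tr tot] := lto.
elim: w => [_|[d|n] w IH wD]; first by have [c Dc] := D0; exists c.
- have [|c Dc wc] := IH; first by move=> e ew; apply: wD; rewrite inE ew orbT.
  have Dd : D d by apply: wD; rewrite inE eqxx.
  have [dc|dc|cd] := tot d c.
  + by exists c => //; apply: words_cons => //; left.
  + by exists c => //; apply: words_cons => //; right.
  + exists d => //; apply: words_cons; first by right.
    apply: words_sub wc => e [ec|->]; left => //; exact: tr ec cd.
- have [|c Dc wc] := IH; first by move=> e ew; apply: wD; rewrite inE ew orbT.
  by exists c => //; exact: words_cons_nat.
Qed.

(** The word [inr 0%N :: w] names [U w], so [U w] contains a point of some stage. That point was
    chosen at a stage [d], and a member of its local pi-base inside [U w] is a new set of stage [d];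
    its thinning is the desired set. *)
Lemma stage_sets_refine w : words D w -> U w !=set0 ->
  exists c t, [/\ D c, words (le_set c) t, (f c).2 t !=set0 & (f c).2 t `<=` U w].
Proof.
move=> wD Uw0; have [c Dc wc] := words_le_set wD.
have NE : named_cap c f [:: inr 0%N :: w] = U w.
  apply/seteqP; split=> [x /(_ (inr 0%N :: w))|x Ux v /=]; first by apply; rewrite /= inE.
  by rewrite inE => /eqP ->.
have [||x []] := stage_points_meet (ws := [:: inr 0%N :: w]) Dc.
- by move=> v; rewrite inE => /eqP ->; exact: words_cons_nat.
- by rewrite NE.
rewrite NE => Ux /(stage_pointsP Dc)[d [ws [Dd wsd un xE]]].
have [oN N0 _] := un; have [_ PN Ppt] := ptP oN N0.
have [|n PU] := Ppt (U w) (oU w); first by rewrite -xE.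
have FE : new_sets d f (encode n ws) = P (named_cap d f ws) n.
  by rewrite /new_sets encodeK asboolT.
have [_ sub V0 _] := stage_setsP Dd.
have encd := words_encode (n := n) wsd.
exists d, (encode n ws); split=> //; first by apply: V0; rewrite // FE; have [] := PN n.
by apply: subset_trans (sub _) _; rewrite FE.
Qed.

(* An uncountable centered family either has uncountably many members from
   one stage, or members from uncountably many stages; in the latter case the
   points chosen at these stages yield a free sequence of length omega_1. *)
Lemma stage_sets_centered_countable :
  centered_countable [set A | exists c t,
    [/\ D c, words (le_set c) t & A = (f c).2 t]].
Proof.
have [_ tr _] := lto.
move=> C CV cC; apply: contrapT => Cunc; have [c0 _] := D0.
have /choice[rk rkP] : forall A, exists ct : W * seq (W + nat), C A ->
    [/\ D ct.1, words (le_set ct.1) ct.2 & A = (f ct.1).2 ct.2].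
  move=> A; have [/CV[c [t AP]]|nCA] := pselect (C A); first by exists (c, t).
  by exists (c0, [::]).
(* A single stage contributes only countably many members, its family being [centered_countable]. *)
have rkunc : ~ countable ((fst \o rk) @` C).
  move=> rkc; apply: Cunc.
  have sub : C `<=` \bigcup_(c in (fst \o rk) @` C) [set A | C A /\ (rk A).1 = c].
    by move=> A CA; exists (rk A).1 => //; exists A.
  apply: sub_countable (subset_card_le sub) _.
  apply: bigcup_countable => // c [B CB rkB].
  have Dc : D c by rewrite -rkB; have [] := rkP B CB.
  have [_ _ _ cc] := stage_setsP Dc; apply: cc.
    by move=> A [CA rkA]; have [_ wA ->] := rkP A CA; exists (rk A).2; rewrite -rkA.
  by apply: centered_sub cC => A [].
have [R [RC R1]] := omega1_like_exists lto rkunc.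
have /choice[m mP] : forall c, exists A, R c -> C A /\ (rk A).1 = c.
  move=> c; have [/RC[A CA rkA]|nRc] := pselect (R c); first by exists A.
  by exists set0.
have mC c : R c -> [/\ C (m c), D c, words (le_set c) (rk (m c)).2 &
    m c = (f c).2 (rk (m c)).2].
  by move=> Rc; have [Cm rkm] := mP c Rc; have := rkP _ Cm; rewrite rkm => -[].
pose E c := (f c).1 |` m @` [set d | R d /\ lt d c].
have cent c : R c -> centered (E c).
  move=> Rc; have [_ Dc _ _] := mC c Rc.
  move=> _ /[swap] /finite_seqP[s ->] sE.
  have /choice[h hP] : forall A, exists d, A \in s -> A <> (f c).1 ->
      [/\ R d, lt d c & m d = A].
    move=> A; have [As|nAs] := boolP (A \in s); last by exists c0.
    by case: (sE A As) => [->|[d [Rd dc] <-]]; [exists c0|exists d].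
  pose s' := [seq A <- s | A != (f c).1].
  have s'P A : A \in s' -> [/\ R (h A), lt (h A) c & m (h A) = A].
    by rewrite mem_filter => /andP[/eqP Ac As]; exact: hP.
  (* These words over [le_set c] name the given earlier sets, so the points of stage [c] meet their
     intersection. *)
  pose ws := [seq inl (h A) :: (rk A).2 | A <- s'].
  have named A : A \in s' -> named_set c f (inl (h A) :: (rk A).2) = A.
    move=> /s'P[Rh hc mh]; have [_ _ wh hE] := mC _ Rh; rewrite mh in wh hE.
    by rewrite /= asboolT.
  have [||x [xN xS]] := stage_points_meet (ws := ws) Dc.
  - move=> _ /mapP[A /s'P[Rh hc mh] ->]; apply: words_cons; first by left.
    have [_ _ wh _] := mC _ Rh; rewrite mh in wh.
    by apply: words_sub wh => e [ec|->]; left => //; exact: tr ec hc.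
  - have [||x xs'] := cC [set` s'].
    + by move=> A /= /s'P[Rh _ <-]; have [] := mC _ Rh.
    + by apply/finite_seqP; exists s'.
    exists x => _ /= /mapP[A As ->]; rewrite named //; exact: xs'.
  exists x => A /= As; have [->//|/eqP Ac] := pselect (A = (f c).1).
  have As' : A \in s' by rewrite mem_filter Ac.
  by rewrite -(named A As'); apply: xN => /=; apply: map_f.
have /choice[z zP] : forall c, exists x, R c -> forall A, E c A -> closure A x.
  move=> c; have [Rc|nRc] := pselect (R c).
    by have [x xP] := compact_centered_closure cX (cent c Rc); exists x.
  by exists (pt setT).
apply: (@no_free_omega1_sequence X _ lt R z (fun a => closure (earlier_points a f))
  (fun a => closure (m a))) => //.
- by move=> a Ra; split; exact: closed_closure.
- move=> a x Ra ex mx; have [_ Da _ mE] := mC a Ra.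
  by apply: (stage_sets_disjoint (w := (rk (m a)).2) Da ex); rewrite -mE.
- move=> a b Ra Rb ba; apply: (closureS (A := (f b).1)); first by move=> x; exists b.
  by apply: zP => //; left.
- by move=> a b Ra Rb ab; apply: zP => //; right; exists a.
Qed.

End Stages.

Lemma thinnable_step (D : set W) : (forall c d, D c -> lt d c -> D d) ->
  (forall c, D c -> thinnable (le_set c)) -> thinnable D.
Proof.
move=> Ddown Dthin; have [->|/set0P D0] := eqVneq D set0; first exact: thinnable_set0.
move=> U oU.
(* In an empty space no family is centered, since even the empty intersection is empty; [U] itself
   then works. *)
have [[x0]|nX] := pselect (inhabited X); last first.
  exists U; split=> [//|w|//|C _ cC]; first exact: subset_refl.
  suff -> : C = set0 by [].
  by apply/seteqP; split=> // A _; have [||x] := cC set0; [| |case: nX].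
have /choice[xP xPP] : forall O : set X, exists xP : X * (nat -> set X),
    open O -> O !=set0 -> [/\ O xP.1,
    forall n, [/\ open (xP.2 n), xP.2 n !=set0 & closure (xP.2 n) `<=` O] &
    forall V, open V -> V xP.1 -> exists n, xP.2 n `<=` V].
  move=> O; have [[oO O0]|nO] := pselect (open O /\ O !=set0).
    by have [x [P xP]] := local_pi_base_within hX cX tX oO O0; exists (x, P).
  by exists (x0, fun=> set0) => oO O0; exfalso; exact: nO.
have /choice[G GP] : forall cF : W * (seq (W + nat) -> set X), exists V,
    D cF.1 -> (forall w, open (cF.2 w)) ->
    [/\ forall w, open (V w), forall w, V w `<=` cF.2 w,
      forall w, words (le_set cF.1) w -> cF.2 w !=set0 -> V w !=set0 &
      centered_countable (V @` words (le_set cF.1))].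
  move=> [c F] /=; have [[Dc oF]|n] := pselect (D c /\ forall w, open (F w)).
    by have [V VP] := Dthin c Dc F oF; exists V.
  by exists F => Dc oF; exfalso; exact: n.
have [wf _ _] := lto.
have [f fE0] := wf_recursion (set0, fun=> set0)
  (stage U (fst \o xP) (snd \o xP) (fun c F => G (c, F))) wf.
have fE c : f c = stage U (fst \o xP) (snd \o xP) (fun c F => G (c, F)) c f.
  by rewrite fE0; apply: stage_ext => d dc; rewrite asboolT.
have GP' c F : D c -> (forall w, open (F w)) -> _ := GP (c, F).
have /choice[V VP] : forall w, exists A : set X, [/\ open A, A `<=` U w,
    words D w -> U w !=set0 -> A !=set0 &
    A !=set0 -> exists c t, [/\ D c, words (le_set c) t & A = (f c).2 t]].
  move=> w; have [[wD Uw]|n] := pselect (words D w /\ U w !=set0); last first.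
    exists set0; split=> //; first exact: open0.
      by move=> wD Uw; exfalso; exact: n.
    by case.
  have [c [t [Dc ct V0 VU]]] := stage_sets_refine Ddown D0 oU xPP GP' fE wD Uw.
  exists ((f c).2 t); split=> // [|_]; last by exists c, t.
  by have [] := stage_setsP xPP GP' fE Dc.
exists V; split=> [w|w|w|C CV cC]; try by have [] := VP w.
apply: (stage_sets_centered_countable Ddown D0 oU xPP GP' fE) => // A CA.
have [w _ VA] := CV A CA; have [_ _ _] := VP w; rewrite VA; apply.
(* Members of a centered family are nonempty, which rules out the default value [set0]. *)
have [||x] := cC [set A].
- by move=> _ ->.
- exact: finite_set1.
- by rewrite bigcap_set1; exists x.
Qed.

(** Well-founded induction gives every [le_set c], passing through the predecessors of [c]; one last
    step collects all of [W]. *)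
Lemma thinnable_setT : thinnable [set: W].
Proof.
have [wf tr _] := lto.
have le c : thinnable (le_set c).
  elim/(well_founded_ind wf): c => c IH; apply: thinnable_le_set.
  apply: thinnable_step => // a b /= ac ba; exact: tr ba ac.
exact: thinnable_step.
Qed.

End Thinning.

Theorem open_sets_thinning (X : topologicalType) :
  hausdorff_space X -> compact [set: X] -> countable_tightness X ->
  exists V : set X -> set X,
    (forall U, open U -> U !=set0 -> [/\ open (V U), V U !=set0 & V U `<=` U]) /\
    centered_countable (V @` [set U | open U /\ U !=set0]).
Proof.
move=> hX cX tX; have [lt lto] := strict_well_order_exists (set X).
(* The sets of [X] serve as letters, and an open [U] is indexed by its one-letter word. *)
pose F (w : seq (set X + nat)) :=
  if w is inl U :: _ then if `[< open U >] then U else set0 else set0.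
have oF w : open (F w).
  case: w => [|[U|n] w] /=; [exact: open0| |exact: open0].
  by case: asboolP => // _; exact: open0.
have [V [oV VF V0 Vc]] := thinnable_setT hX cX tX lto oF.
have FE U : open U -> F [:: inl U] = U by move=> oU; rewrite /F asboolT.
exists (fun U => V [:: inl U]); split=> [U oU U0|C CV].
  by split; [|apply: V0; rewrite ?FE|rewrite -[X in _ `<=` X](FE U oU)].
by apply: Vc => A /CV[U _ <-]; exists [:: inl U].
Qed.

(** * The ccc order of finite subfamilies *)

Lemma ultra_has {T : Type} {I : eqType} (F : set_system T) (s : seq I)
    (Q : I -> set T) : UltraFilter F ->
  F [set x | exists2 i, i \in s & Q i x] -> exists2 i, i \in s & F (Q i).
Proof.
move=> FU; elim: s => [|i s IH] Fs.
  by have [x []] := filter_ex Fs.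
have [FQ|FnQ] := in_ultra_setVsetC (Q i) FU; first by exists i; rewrite ?inE ?eqxx.
have [|j js Fj] := IH; last by exists j => //; rewrite inE js orbT.
apply: filterS (filterI Fs FnQ) => x [[j]].
by rewrite inE => /predU1P[->|js] Qx nQx //; exists j.
Qed.

Lemma filter_all {T : Type} {I : eqType} (F : set_system T) (s : seq I)
    (Q : I -> set T) : Filter F ->
  (forall i, i \in s -> F (Q i)) -> F [set x | forall i, i \in s -> Q i x].
Proof.
move=> FF; elim: s => [|i s IH] Fs; first by apply: filterS filterT.
have Fi : F (Q i) by apply: Fs; rewrite inE eqxx.
have {}IH : F [set x | forall j, j \in s -> Q j x].
  by apply: IH => j js; apply: Fs; rewrite inE js orbT.
apply: filterS (filterI Fi IH) => x [Qi Qs] j.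
by rewrite inE => /predU1P[->|/Qs].
Qed.

Lemma uncountable_fiber {T I : Type} (A : set T) (D : set I) (g : T -> I) :
  countable D -> (forall x, A x -> D (g x)) -> ~ countable A ->
  exists2 i, D i & ~ countable [set x | A x /\ g x = i].
Proof.
move=> cD AD Aunc; apply: contrapT => nfib; apply: Aunc.
have sub : A `<=` \bigcup_(i in D) [set x | A x /\ g x = i].
  by move=> x Ax; exists (g x); [exact: AD|].
apply: sub_countable (subset_card_le sub) _; apply: bigcup_countable => // i Di.
by apply: contrapT => ?; apply: nfib; exists i.
Qed.

Section FiniteSubfamilies.
Variables (X : Type) (B : set (set X)).
Hypotheses (B0 : forall A, B A -> A !=set0) (cB : centered_countable B).

Definition condition := {p : set (set X) | finite_set p /\ p `<=` B}.

Definition extends (q p : condition) : Prop :=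
  sval p `<=` sval q /\
  forall u v, sval q u -> ~ sval p u -> sval p v -> ~ v `<=` u.

Lemma extends_partial_order : is_partial_order extends.
Proof.
split=> [p|]; first by split=> // u v pu npu.
split=> [p q r [qp pq] [rq qr]|].
  split=> [|u v pu nru rv]; first exact: subset_trans qp.
  have [qu|nqu] := pselect (sval q u); first exact: qr.
  by apply: pq => //; exact: rq.
move=> [p pP] [q qP] [/= qp _] [/= pq _].
have pqE : p = q by apply/seteqP.
by subst q; congr exist; exact: Prop_irrelevance.
Qed.

(** All supersets of [v] share a point of [v], hence form a centered family. *)
Lemma countable_supersets v : B v -> countable [set u | B u /\ v `<=` u].
Proof.
move=> Bv; apply: cB => [u []//|D Dsub _].
by have [x vx] := B0 Bv; exists x => u /Dsub[_]; exact.
Qed.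

Section Antichain.
Variable e : condition -> seq (set X).
Hypothesis eE : forall p, sval p = [set` e p].

(* [r] plays the role of the root of a Delta-system. *)
Lemma uncountable_root (A : set condition) (n : nat) :
  (forall p, A p -> size (e p) = n) -> ~ countable A ->
  exists r : seq (set X), ~ countable [set p | A p /\ {subset r <= e p}] /\
    forall v, v \notin r ->
      countable [set p | [/\ A p, {subset r <= e p} & v \in e p]].
Proof.
move=> An Aunc.
pose rooted k := `[< exists r : seq (set X), [/\ uniq r, size r = k &
  ~ countable [set p | A p /\ {subset r <= e p}]] >].
have ex0 : exists k, rooted k.
  exists 0%N; apply/asboolP; exists [::]; split=> // cA; apply: Aunc.
  by apply: sub_countable cA; apply: subset_card_le.
have bd k : rooted k -> (k <= n)%N.
  move=> /asboolP[r [ur <- unc]].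
  have [p [Ap rp]] : [set p | A p /\ {subset r <= e p}] !=set0.
    by apply/set0P/eqP => E; apply: unc; rewrite E.
  by rewrite -(An p Ap); exact: uniq_leq_size.
(* A root of maximal size works: if some [v] outside [r] belonged to uncountably many of these
   conditions, [v :: r] would be a larger root. *)
case: (ex_maxnP ex0 bd) => k /asboolP[r [ur rk unc]] kmax.
exists r; split=> // v vr; apply: contrapT => vunc.
have : rooted k.+1.
  apply/asboolP; exists (v :: r); split; rewrite /= ?vr ?rk // => cv; apply: vunc.
  apply: sub_countable cv; apply: subset_card_le => p [Ap rp vp]; split=> // u.
  by rewrite inE => /predU1P[->|/rp].
by move=> /kmax; rewrite ltnn.
Qed.

Lemma extends_ccc_aux (A : set condition) : antichain extends A -> countable A.
Proof.
move=> anti; apply: contrapT => Aunc0.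
have [n _ Aunc1] := uncountable_fiber (g := size \o e) (D := setT)
  (countableP _) (fun _ _ => I) Aunc0.
have [|r [Aunc rcnt]] := uncountable_root (n := n) _ Aunc1; first by move=> p [].
set A' := [set p | _ /\ _] in Aunc.
have A'A p : A' p -> A p by move=> [[]].
have A'n p : A' p -> size (e p) = n by move=> [[]].
have A'r p : A' p -> {subset r <= e p} by move=> [].
have {}rcnt v : v \notin r -> countable [set p | A' p /\ v \in e p].
  by move=> /rcnt; apply: sub_countable; apply: subset_card_le => p [[]].
have eB p u : u \in e p -> B u by move=> up; apply: (svalP p).2; rewrite eE.
(* Each of the finitely many [v] in [p] has countably many supersets in [B], and each of these
   outside [r] belongs to countably many [q]. *)
have bad_countable p : A' p -> countable [set q | A' q /\ (q = p \/
    exists u v, [/\ u \in e q, u \notin r, v \in e p & v `<=` u])].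
  move=> A'p.
  have sub : [set q | A' q /\ (q = p \/
      exists u v, [/\ u \in e q, u \notin r, v \in e p & v `<=` u])] `<=`
    [set p] `|` \bigcup_(v in [set` e p]) \bigcup_(u in
      [set u | (B u /\ v `<=` u) /\ u \notin r]) [set q | A' q /\ u \in e q].
    move=> q [A'q [->|[u [v [uq ur vp vu]]]]]; first by left.
    by right; exists v => //; exists u => //; split=> //; split=> //; exact: eB uq.
  apply: sub_countable (subset_card_le sub) _.
  apply: countable_setU; first exact: countable1.
  apply: bigcup_countable => [|v vp].
    by apply: finite_set_countable; apply/finite_seqP; eexists.
  apply: bigcup_countable => [|u [_ ur]]; last exact: rcnt.
  apply: sub_countable (countable_supersets (eB _ _ vp)).
  by apply: subset_card_le => u [].
(* The union of [p] and [q] is not a common extension. If no member of [q] outside [r] is to blame,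
   some member of [p] outside [r] contains a member of [q]. *)
have incompat p q : A' p -> A' q -> q <> p ->
    ~ (exists u v, [/\ u \in e q, u \notin r, v \in e p & v `<=` u]) ->
    exists u v, [/\ u \in e p, u \notin r, v \in e q & v `<=` u].
  move=> A'p A'q qp nbad; apply: contrapT => nbad'.
  apply: (anti q p (A'A _ A'q) (A'A _ A'p) qp).
  have fin : finite_set (sval p `|` sval q) /\ sval p `|` sval q `<=` B.
    have [[fp pB] [fq qB]] := (svalP p, svalP q).
    by split; [rewrite finite_setU|rewrite subUset].
  exists (exist (fun p => finite_set p /\ p `<=` B) _ fin); split; split=> /=.
  - exact: subsetUr.
  - move=> u v [pu|//] nqu qv vu; apply: nbad'; exists u, v; rewrite !eE /= in pu nqu qv.
    by split=> //; apply/negP => /(A'r _ A'q).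
  - exact: subsetUl.
  - move=> u v [//|qu] npu pv vu; apply: nbad; exists u, v; rewrite !eE /= in qu npu pv.
    by split=> //; apply/negP => /(A'r _ A'p).
(* For fixed [p], [incompat] applies to all but countably many [q]. An ultrafilter containing the
   co-countable sets therefore selects one [u] in [p] and one position [i] such that, for almost
   every [q], the [i]-th member of [q] lies in [u]. *)
pose cocountable := [set S : set condition | countable (A' `\` S)].
have coF : ProperFilter cocountable.
  split; first by rewrite /cocountable /= setD0.
  split.
  - by rewrite /cocountable /= setDT.
  - by move=> S T cS cT; rewrite /cocountable /= setDIr; exact: countable_setU.
  - move=> S T ST; apply: sub_countable; apply: subset_card_le.
    exact: setDS.
have [F [FU Fco]] := ultraFilterLemma coF.
have pick p : A' p -> exists ui : set X * nat, [/\ ui.1 \in e p, ui.1 \notin r,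
    (ui.2 < n)%N & F [set q | A' q /\ nth set0 (e q) ui.2 `<=` ui.1]].
  move=> A'p.
  pose s := [seq (u, i) | u <- [seq u <- e p | u \notin r], i <- iota 0 n].
  have [|ui] := @ultra_has _ _ F s
      (fun ui => [set q | A' q /\ nth set0 (e q) ui.2 `<=` ui.1]) FU.
    apply: Fco; apply: sub_countable (bad_countable p A'p).
    apply: subset_card_le => q [A'q nq]; split=> //; apply: contrapT => nbad.
    have [u [v [up ur vq vu]]] : exists u v,
        [/\ u \in e p, u \notin r, v \in e q & v `<=` u].
      by apply: incompat => // [qp|bad]; apply: nbad; [left|right].
    apply: nq; exists (u, index v (e q)); last by rewrite /= nth_index.
    apply/allpairsP; exists (u, index v (e q)); split=> //=.
      by rewrite mem_filter ur.
    by rewrite mem_iota /= add0n -(A'n q A'q) index_mem.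
  move=> /allpairsP[[u i] [/=]]; rewrite mem_filter mem_iota add0n.
  by move=> /andP[ur up] /= ? -> ?; exists (u, i).
have /choice[g gP] : forall p, exists ui : set X * nat, A' p ->
    [/\ ui.1 \in e p, ui.1 \notin r,
    (ui.2 < n)%N & F [set q | A' q /\ nth set0 (e q) ui.2 `<=` ui.1]].
  move=> p; have [/pick[ui ?]|np] := pselect (A' p); first by exists ui.
  by exists (set0, 0%N).
have [i _ Aiunc] := uncountable_fiber (g := snd \o g) (D := setT)
  (countableP _) (fun _ _ => I) Aunc.
pose C := (fst \o g) @` [set p | A' p /\ (snd \o g) p = i].
(* Finitely many members of [C] all contain the nonempty [i]-th member of a single [q]. *)
have cC : countable C.
  apply: cB => [_ [p [A'p _] <-]|]; first by have [/eB] := gP p A'p.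
  move=> _ /[swap] /finite_seqP[s ->] sC.
  have [|q qs] := filter_ex (filter_all (F := F) (s := s)
      (Q := fun u => [set q | A' q /\ ((i < n)%N /\ nth set0 (e q) i `<=` u)]) _ _).
    move=> u /sC[p [A'p gi] <-]; have [_ _ gn] := gP p A'p.
    by rewrite [(g p).2]gi in gn *; apply: filterS => q [].
  case: s sC qs => [|u0 s] sC qs.
    have [q0 [A'q0 _]] : [set p | A' p /\ (snd \o g) p = i] !=set0.
      by apply/set0P/eqP => E; apply: Aiunc; rewrite E.
    have [/eB/B0[x _] _ _ _] := gP q0 A'q0.
    by exists x.
  have [|A'q [iq _]] := qs u0; first by rewrite inE eqxx.
  have [x xq] : nth set0 (e q) i !=set0.
    by apply: B0; apply: (eB q); apply: mem_nth; rewrite A'n.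
  by exists x => u /= /qs[_ [_]]; apply.
(* Each such [p] has a member in [C] outside [r], and each set outside [r] belongs to only countably
   many conditions of [A']. *)
apply: Aiunc.
have sub : [set p | A' p /\ (snd \o g) p = i] `<=`
    \bigcup_(u in C `&` [set u | u \notin r]) [set p | A' p /\ u \in e p].
  move=> p [A'p gi]; have [gp gr _ _] := gP p A'p.
  by exists (g p).1 => //; split=> //; exists p.
apply: sub_countable (subset_card_le sub) _.
apply: bigcup_countable => [|u [_ ur]]; last exact: rcnt.
by apply: sub_countable cC; apply: subset_card_le => u [].
Qed.

End Antichain.

Lemma extends_ccc : ccc extends.
Proof.
have /choice[e eE] : forall p : condition, exists s : seq (set X), sval p = [set` s].
  by move=> p; apply/finite_seqP; exact: (svalP p).1.
exact: extends_ccc_aux eE.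
Qed.

Lemma omega_op_like_subfamily (E : set (set X)) : MartinsAxiom ->
  lt_continuum E -> (forall s, E s -> exists2 t, B t & t `<=` s) ->
  exists C : set (set X), [/\ C `<=` B, omega_op_like C &
    forall s, E s -> exists2 t, C t & t `<=` s].
Proof.
move=> MA [Ele Ege] EB.
pose meeting s := [set p : condition | exists2 t, sval p t & t `<=` s].
have cond0 : finite_set (set0 : set (set X)) /\ set0 `<=` B by split.
have [||G [[_ [_ Gdir]] Gmeet]] := MA condition extends
  (inhabits (exist (fun p => finite_set p /\ p `<=` B) _ cond0))
  extends_partial_order extends_ccc (meeting @` E).
- split; first exact: card_le_trans (card_image_le _ _) Ele.
  by move=> h; apply: Ege; exact: card_le_trans h (card_image_le _ _).
- move=> _ [s Es <-] p; have [ps|nps] := pselect (meeting s p).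
    by exists p; split=> //; exact: extends_partial_order.1.
  (* Adding [t] gives an extension of [p]: a member of [p] inside [t] would also be inside [s],
     against [nps]. *)
  have [t Bt ts] := EB s Es.
  have fin : finite_set (t |` sval p) /\ t |` sval p `<=` B.
    have [fp pB] := svalP p; split; first by rewrite finite_setU.
    by move=> u [->|/pB].
  exists (exist (fun p => finite_set p /\ p `<=` B) _ fin).
  split; first by exists t => //; left.
  split=> /= [u pu|u v [->|//] npt pv vt]; first by right.
  by apply: nps; exists v => //; exact: subset_trans ts.
exists (\bigcup_(p in G) sval p); split.
- by move=> u [p _ pu]; exact: (svalP p).2.
(* A common extension of [p] and [q] has no superset of [u] outside [p], so all supersets of [u] in
   the union lie in the finite set [p]. *)
- move=> u [p Gp pu]; apply: sub_finite_set (svalP p).1 => w [[q Gq qw] uw].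
  have [t [Gt [[tp tpn] [tq _]]]] := Gdir p q Gp Gq.
  by apply: contrapT => npw; apply: (tpn w u) => //; exact: tq.
- move=> s Es; have [p [Gp [t pt ts]]] := Gmeet _ (imageP meeting Es).
  by exists t => //; exists p.
Qed.

End FiniteSubfamilies.

Unset Implicit Arguments.

Theorem theorem2p30 :
  MartinsAxiom ->
  forall X : topologicalType,
    hausdorff_space X -> compact [set: X] ->
    countable_tightness X ->
    pi_weight_lt_continuum X ->
    piNt_eq_omega X.
Proof.
move=> MA X hX cX tX [E [[oE Epi] Elt]].
have [V [VP Vc]] := open_sets_thinning hX cX tX.
set B := V @` _ in Vc.
have BP A : B A -> open A /\ A !=set0.
  by move=> [U [oU U0] <-]; have [] := VP U oU U0.
have [s Es|C [CB Cop CE]] :=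
    omega_op_like_subfamily (fun A BA => (BP A BA).2) Vc MA Elt.
  have [os s0] := oE s Es; have [_ _ Vs] := VP s os s0.
  by exists (V s) => //; exists s.
exists C; split=> //; split=> [U /CB/BP//|U oU U0].
have [s [Es sU]] := Epi U oU U0; have [t Ct ts] := CE s Es.
by exists t; split=> //; exact: subset_trans sU.
Qed.
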